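(* Let $b\in\mathbb{R}^n\setminus\mathbb{Z}^n$. Then $\operatorname{aff}(M_b)=\mathbb{R}^{(\mathbb{R}^n)}\times\mathbb{R}^{(\mathbb{R}^n)}$.
   Context: $\mathbb{R}^{(\mathbb{R}^n)}$ is the real vector space of functions $\mathbb{R}^n\to\mathbb{R}$ with finite support. $M_b\subseteq\mathbb{R}^{(\mathbb{R}^n)}\times\mathbb{R}^{(\mathbb{R}^n)}$ is the set of all pairs $(s,y)$ of finite-support functions $s:\mathbb{R}^n\to\mathbb{R}_+$, $y:\mathbb{R}^n\to\mathbb{Z}_+$ such that $\sum_{r\in\mathbb{R}^n} r\,s(r)+\sum_{p\in\mathbb{R}^n}p\,y(p)\in b+\mathbb{Z}^n$. $\operatorname{aff}(C)$ denotes the set of (finite) affine combinations of points of $C$. *)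

(* Defs.v *)
From mathcomp Require Import all_boot all_order all_algebra.
From mathcomp Require Import finmap.
From mathcomp Require Import classical_sets reals.
From mathcomp Require Import monalg.

Set Implicit Arguments.
Unset Strict Implicit.
Unset Printing Implicit Defensive.

Import Order.TTheory GRing.Theory Num.Theory.
Local Open Scope classical_set_scope.
Local Open Scope ring_scope.

(* {malg R['rV[R]_n]} is used only as the lmodType of finitely supported
   functions 'rV[R]_n -> R, with s@_r the value at r and msupp s the support. *)
Definition finsuppfun (R : realType) (n : nat) : lmodType R :=
  {malg R['rV[R]_n]}.

Definition int_lattice (R : realType) (n : nat) : set 'rV[R]_n :=
  [set z | forall j, z ord0 j \is a Num.int].

(* The value of \sum_r r * s(r); outside msupp s all terms vanish. *)
Definition weighted_sum (R : realType) (n : nat) (s : finsuppfun R n) :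
    'rV[R]_n :=
  \sum_(r <- msupp s) s@_r *: r.

Definition Mb (R : realType) (n : nat) (b : 'rV[R]_n) :
    set (finsuppfun R n * finsuppfun R n) :=
  [set sy | [/\ forall r, 0 <= sy.1@_r,
                forall p, sy.2@_p \is a Num.nat &
                [set b + z | z in @int_lattice R n]
                  (weighted_sum sy.1 + weighted_sum sy.2)]].

Definition aff (R : realType) (V : lmodType R) (C : set V) : set V :=
  [set x | exists (m : nat) (c : 'I_m -> R) (v : 'I_m -> V),
     [/\ forall i, C (v i), \sum_(i < m) c i = 1 &
         x = \sum_(i < m) c i *: v i]].

(* Main.v *)
Require Import Defs.
From mathcomp Require Import all_boot all_order all_algebra.
From mathcomp Require Import finmap.
From mathcomp Require Import classical_sets reals.
From mathcomp Require Import monalg.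

Import Order.TTheory GRing.Theory Num.Theory.
Local Open Scope classical_set_scope.
Local Open Scope ring_scope.

(** The directions [d] along which the affine hull of [M_b] is invariant form a
    linear subspace. It contains [M_0], because [M_b + M_0] is contained in
    [M_b]. Writing [[r]] for the indicator function of [r], the pairs
    [(a[r] + [- a r], 0)] (with [a >= 0]) and [([r] + [q] + [- (r + q)], 0)] lie
    in [M_0], so the set of [r] such that [([r], 0)] is a direction is a linear
    subspace of [R^n]; it contains the unit vectors and is thus [R^n]. Since
    [([- p], [p])] lies in [M_0], the pairs [(0, [p])] are directions as well.
    Hence every pair is a direction, and [M_b] is not empty. *)

Lemma aff_fintype {R : realType} {V : lmodType R} (C : set V) (I : finType)
    (c : I -> R) (v : I -> V) :
  (forall i, C (v i)) -> \sum_i c i = 1 -> aff C (\sum_i c i *: v i).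
Proof.
move=> Cv c1; exists #|I|, (c \o enum_val), (v \o enum_val); split.
- by move=> i; apply: Cv.
- by rewrite -c1 [RHS](reindex _ (onW_bij _ (enum_val_bij I))).
- by rewrite [LHS](reindex _ (onW_bij _ (enum_val_bij I))).
Qed.

Lemma sub_aff {R : realType} {V : lmodType R} (C : set V) : C `<=` aff C.
Proof.
move=> x Cx; exists 1%N, (fun=> 1), (fun=> x); split=> //.
- by rewrite big_ord1.
- by rewrite big_ord1 scale1r.
Qed.

(** Letting [t] range over all scalars and [x] over the whole hull makes closure under scaling and
    addition immediate: moves can be rescaled and chained. *)
Definition aff_dir {R : realType} {V : lmodType R} (C : set V) : set V :=
  [set d | forall x t, aff C x -> aff C (x + t *: d)].

Lemma aff_dirB {R : realType} {V : lmodType R} (C : set V) (y z : V) :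
  C y -> C z -> aff_dir C (y - z).
Proof.
move=> Cy Cz _ t [m [c [v [Cv c1 ->]]]].
(* Two terms are appended to the combination, [y] with coefficient [t] and [z] with [- t]; they
   cancel in the coefficient sum, which stays 1. *)
pose c' (i : 'I_m + bool) :=
  match i with inl j => c j | inr k => if k then t else - t end.
pose v' (i : 'I_m + bool) :=
  match i with inl j => v j | inr k => if k then y else z end.
have -> : \sum_(i < m) c i *: v i + t *: (y - z) = \sum_i c' i *: v' i.
  by rewrite big_sumType big_bool /= scaleNr -scalerBr.
apply: aff_fintype => [[j|[]]|] //; first exact: Cv.
by rewrite big_sumType big_bool /= subrr addr0.
Qed.

Section Directions.
Context {R : realType} {V : lmodType R} (C : set V).

Lemma aff_dir0 : aff_dir C 0.
Proof. by move=> x t; rewrite scaler0 addr0. Qed.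

Lemma aff_dirD (d e : V) : aff_dir C d -> aff_dir C e -> aff_dir C (d + e).
Proof.
by move=> Dd De x t Cx; rewrite scalerDr addrA; apply/De/Dd.
Qed.

Lemma aff_dirZ (a : R) (d : V) : aff_dir C d -> aff_dir C (a *: d).
Proof. by move=> Dd x t; rewrite scalerA; apply: Dd. Qed.

Lemma aff_dirDr (d e : V) : aff_dir C d -> aff_dir C (d + e) -> aff_dir C e.
Proof.
move=> Dd Dde; rewrite -(addKr d e) -scaleN1r.
by apply: aff_dirD => //; apply: aff_dirZ.
Qed.

Lemma aff_dir_sum (I : Type) (s : seq I) (F : I -> V) :
  (forall i, aff_dir C (F i)) -> aff_dir C (\sum_(i <- s) F i).
Proof.
by move=> DF; apply: big_ind => //; [exact: aff_dir0|exact: aff_dirD].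
Qed.

End Directions.

Section WeightedSum.
Context {R : realType} {n : nat}.
Implicit Types (s t : finsuppfun R n) (r b : 'rV[R]_n) (a : R).

(** Allows a common index set for functions with different supports, and a singleton for
    [point_mass a r], whose support is empty when [a = 0]. *)
Lemma weighted_sum_sub (D : {fset 'rV[R]_n}) s : (msupp s `<=` D)%fset ->
  weighted_sum s = \sum_(r <- D) s@_r *: r.
Proof.
move=> sD; apply: big_fset_incl => // r _ /mcoeff_outdom ->.
by rewrite scale0r.
Qed.

Lemma weighted_sumD s t : weighted_sum (s + t) = weighted_sum s + weighted_sum t.
Proof.
rewrite (weighted_sum_sub _ _ (msuppD_le s t)).
rewrite (weighted_sum_sub _ s (fsubsetUl (msupp s) (msupp t))).
rewrite (weighted_sum_sub _ t (fsubsetUr (msupp s) (msupp t))).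
by rewrite -big_split; apply: eq_bigr => r _; rewrite mcoeffD scalerDl.
Qed.

Definition point_mass a r : finsuppfun R n := << a *g r >>.

Lemma weighted_sum_point a r : weighted_sum (point_mass a r) = a *: r.
Proof.
by rewrite (weighted_sum_sub _ _ msuppU_le) big_seq_fset1 mcoeffUU.
Qed.

Lemma weighted_sum0 : weighted_sum (0 : finsuppfun R n) = 0.
Proof. by rewrite /weighted_sum msupp0 big_seq_fset0. Qed.

Lemma scale_point_mass a r : a *: point_mass 1 r = point_mass a r.
Proof. by apply/malgP => k; rewrite mcoeffZ !mcoeffU mulrnAr mulr1. Qed.

Lemma point_mass_ge0 a r k : 0 <= a -> 0 <= (point_mass a r)@_k.
Proof. by move=> a0; rewrite mcoeffU mulrn_wge0. Qed.

(** Taking opposite [b] and [b'] yields elements of [Mb 0]; taking [b = 0] gives the stability of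
    [Mb b'] under adding them. *)
Lemma MbD b b' x y : Mb b x -> Mb b' y -> Mb (b + b') (x + y).
Proof.
case=> x1 x2 [z Zz zE] [y1 y2 [z' Zz' zE']]; split.
- by move=> r; rewrite mcoeffD addr_ge0.
- by move=> p; rewrite mcoeffD rpredD.
- exists (z + z'); first by move=> j; rewrite mxE rpredD.
  by rewrite !weighted_sumD addrACA zE zE' addrACA.
Qed.

Lemma Mb_point a r : 0 <= a -> Mb (a *: r) (point_mass a r, 0).
Proof.
move=> a0; split=> /= [k|p|].
- exact: point_mass_ge0.
- by rewrite mcoeff0.
- exists 0; first by move=> j; rewrite mxE.
  by rewrite weighted_sum_point weighted_sum0.
Qed.

Lemma Mb_point1 r : Mb r (point_mass 1 r, 0).
Proof. by rewrite -{1}[r]scale1r; apply: Mb_point. Qed.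

Lemma Mb_point2 r : Mb r (0, point_mass 1 r).
Proof.
split=> /= [k|p|].
- by rewrite mcoeff0.
- by rewrite mcoeffU natr_nat.
- exists 0; first by move=> j; rewrite mxE.
  by rewrite weighted_sum_point weighted_sum0 scale1r addrC.
Qed.

Lemma Mb_int b x : int_lattice b -> Mb b x -> Mb 0 x.
Proof.
move=> Zb [x1 x2 [z Zz zE]]; split=> //; exists (b + z); last by rewrite add0r.
by move=> j; rewrite mxE rpredD.
Qed.

(** Both [x + (point_mass 1 b, 0)] and [(point_mass 1 b, 0)] lie in [Mb b], and [x] is their
    difference. *)
Lemma Mb0_dir b x : Mb 0 x -> aff_dir (Mb b) x.
Proof.
move=> M0x; rewrite -(addrK (point_mass 1 b, 0) x).
apply: aff_dirB; last exact: Mb_point1.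
by rewrite -[b in Mb b]add0r; apply: MbD => //; apply: Mb_point1.
Qed.

Lemma Mb_dir_first b r : aff_dir (Mb b) (point_mass 1 r, 0).
Proof.
pose E q := aff_dir (Mb b) (point_mass 1 q, 0).
(* The scalar is carried by the mass at [q], not by its location: mass [a] at [q] is a multiple of a
   known direction, and nonnegativity of the mass forces [0 <= a]. *)
have EZ a q : 0 <= a -> E q -> E (- (a *: q)).
  move=> a0 Eq; apply: (@aff_dirDr _ _ _ (a *: (point_mass 1 q, 0))).
    exact: aff_dirZ.
  apply: Mb0_dir; rewrite -(subrr (a *: q)); apply: MbD (Mb_point1 _).
  have -> : a *: (point_mass 1 q, 0) = (point_mass a q, 0)
              :> finsuppfun R n * finsuppfun R n.
    by congr pair; rewrite /= ?scaler0 ?scale_point_mass.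
  exact: Mb_point.
have EN q : E q -> E (- q) by move=> /(EZ 1 q ler01); rewrite scale1r.
have ED p q : E p -> E q -> E (p + q).
  move=> Ep Eq; rewrite -(opprK (p + q)); apply: EN.
  (* Unit masses at [p], [q] and [- (p + q)] add up to an element of [Mb 0]; the first two are
     stripped off. *)
  apply: (aff_dirDr _ _ _ (aff_dirD _ _ _ Ep Eq)).
  by apply: Mb0_dir; rewrite -(subrr (p + q)); apply: MbD (Mb_point1 _);
     apply: MbD; apply: Mb_point1.
have Eint q : int_lattice q -> E q.
  by move=> Zq; apply/Mb0_dir/(Mb_int q) => //; apply: Mb_point1.
rewrite -/(E r) [r]row_sum_delta; apply: big_ind => //.
  by apply: Eint => j; rewrite mxE.
move=> j _; have Ej : E (delta_mx 0 j) by apply: Eint => k; rewrite mxE rpred_nat.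
(* [EZ] takes a nonnegative scalar and flips the sign, so a nonnegative coordinate needs a further
   [EN], while a negative one is covered by [EZ] applied to its opposite. *)
have [a0|/ltW a0] := leP 0 (r 0 j).
  by rewrite -(opprK (_ *: _)); apply/EN/EZ.
by rewrite -(opprK (r 0 j)) scaleNr; apply: EZ => //; rewrite oppr_ge0.
Qed.

(** The unit mass at [- p] in the first component offsets [p], and is itself a direction that can be
    removed. *)
Lemma Mb_dir_second b p : aff_dir (Mb b) (0, point_mass 1 p).
Proof.
apply: (aff_dirDr _ _ _ (Mb_dir_first b (- p))); apply: Mb0_dir.
by rewrite -(addNr p); apply: MbD; [exact: Mb_point1|exact: Mb_point2].
Qed.

Lemma finsuppfunE s : s = \sum_(r <- msupp s) s@_r *: point_mass 1 r.
Proof.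
by rewrite {1}[s]monalgE; apply: eq_bigr => r _; rewrite scale_point_mass.
Qed.

Lemma Mb_dirT b x : aff_dir (Mb b) x.
Proof.
have -> : x = \sum_(r <- msupp x.1) x.1@_r *: (point_mass 1 r, 0)
            + \sum_(p <- msupp x.2) x.2@_p *: (0, point_mass 1 p).
  case: x => s y; congr pair => /=.
    (* The projections are additive, and each one kills the sum that lives in the other
       component. *)
    rewrite !raddf_sum /= [X in _ + X]big1 ?addr0.
      exact: finsuppfunE.
    by move=> p _; rewrite scaler0.
  rewrite !raddf_sum /= [X in X + _]big1 ?add0r.
    exact: finsuppfunE.
  by move=> p _; rewrite scaler0.
apply: aff_dirD; apply: aff_dir_sum => r; apply: aff_dirZ.
- exact: Mb_dir_first.
- exact: Mb_dir_second.
Qed.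

End WeightedSum.

Theorem proposition3p2 (R : realType) (n : nat) (b : 'rV[R]_n)
    (hb : ~ int_lattice b) :
  aff (Mb b) = [set: (finsuppfun R n * finsuppfun R n)%type].
Proof.
apply/seteqP; split=> // x _.
have Ab : aff (Mb b) (point_mass 1 b, 0) by apply/sub_aff/Mb_point1.
(* [x] is reached from the base point [(point_mass 1 b, 0)] by one move with [t = 1] along their
   difference. *)
rewrite -(subrK (point_mass 1 b, 0) x) addrC -[x - _]scale1r.
exact: Mb_dirT.
Qed.
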